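(* Let $L$ be a reduced Latin square of order $n$ with row permutations $\sigma_1,\dots,\sigma_n$, and let $\sigma_l$ be a row of $L$ whose cycle representation has the minimal number of cycles among all rows, i.e. $\nu(\sigma_l)=\nu(L)$. Suppose $\sigma_l=(C_1)(C_2)\cdots(C_{\nu(L)})$ is the decomposition of $\sigma_l$ into disjoint cycles (cycles of length 1 included), and assume that $l\in C_1$. Then $$|\mathfrak{A}(L)|\le n\,\delta(L)\,\lambda(L,l)\prod_{i=2}^{\nu(L)}\lambda(L,C_i).$$
   Context: A Latin square of order $n$ is an $n\times n$ array with entries in $[n]=\{1,\dots,n\}$ such that each row and each column is a permutation of $[n]$. It is reduced if its first row and first column are both the identity permutation. Row $i$ of $L$ is viewed as the permutation $\sigma_i\in S_n$ with $\sigma_i(j)=L(i,j)$. Permutations are composed as functions, right to left. An isotopism is a triple $(\alpha,\beta,\gamma)\in S_n^3$, acting on Latin squares of order $n$ by permuting rows by $\alpha$, columns by $\beta$ and symbols by $\gamma$: $L'=(\alpha,\beta,\gamma)(L)$ is given by $L'(\alpha(i),\beta(j))=\gamma(L(i,j))$. The autotopy group $\mathfrak{A}(L)$ is the group of isotopisms $\Theta$ with $\Theta(L)=L$. For $\sigma\in S_n$, $\nu(\sigma)$ is the number of cycles in its disjoint cycle decomposition, including cycles of length 1; the cycle structure of $\sigma$ is the partition of $n$ given by its cycle lengths. Put $\nu(L)=\min_i\nu(\sigma_i)$. For $s\in[n]$, $\lambda(L,s)$ is the number of rows of $L$ with the same cycle structure as $\sigma_s$ (including $\sigma_s$ itself).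 For a cycle $C$ of a row permutation of $L$ (identified with its set of elements), $\lambda(L,C)=\min_{s\in C}\lambda(L,s)$. $\Delta(L)$ is the set of $m\in[n]$ such that the multiset of cycle structures of the permutations $\sigma_i\sigma_m^{-1}$, $i=1,\dots,n$, equals the multiset of cycle structures of $\sigma_1,\dots,\sigma_n$. Put $\delta(L)=|\Delta(L)|$. *)

(* Defs.v *)
(* The index/symbol set [n] = {1, ..., n} is 'I_n = {0, ..., n-1}. *)
From mathcomp Require Import all_boot all_fingroup all_algebra.

Set Implicit Arguments.
Unset Strict Implicit.
Unset Printing Implicit Defensive.

Local Open Scope nat_scope.

(* On a finite set, injective rows and columns are permutations. *)
Definition is_latin n (A : 'M['I_n]_n) : bool :=
  [forall i, injectiveb (fun j => A i j)] &&
  [forall j, injectiveb (fun i => A i j)].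

Record latin_square (n : nat) := LatinSquare {
  ls_mx :> 'M['I_n]_n;
  _ : is_latin ls_mx
}.

Lemma ls_row_inj n (L : latin_square n) i : injective (fun j => L i j).
Proof. by case: L => A /= /andP[/forallP/(_ i)/injectiveP]. Qed.

Definition ls_row n (L : latin_square n) (i : 'I_n) : 'S_n :=
  perm (@ls_row_inj n L i).

Definition reduced n (L : latin_square n) : Prop :=
  forall z : 'I_n, val z = 0 -> forall i : 'I_n, L z i = i /\ L i z = i.

(* L' (alpha i) (beta j) = gamma (L i j), solved for L'. *)
Definition isotope n (Theta : 'S_n * 'S_n * 'S_n) (A : 'M['I_n]_n) :
    'M['I_n]_n :=
  let: (alpha, beta, gamma) := Theta in
  \matrix_(i, j) gamma (A (alpha^-1%g i) (beta^-1%g j)).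

Definition autotopy n (L : latin_square n) : {set 'S_n * 'S_n * 'S_n} :=
  [set Theta | isotope Theta L == L].

(* In MathComp (s * t) x = t (s x), so isotope is a right action. *)
Lemma isotope1 n (A : 'M['I_n]_n) : isotope 1%g A = A.
Proof. by apply/matrixP => i j; rewrite mxE !invg1 !perm1. Qed.

Lemma isotopeM n (S T : 'S_n * 'S_n * 'S_n) (A : 'M['I_n]_n) :
  isotope (S * T)%g A = isotope T (isotope S A).
Proof.
by case: S T => [[a b] c] [[a' b'] c']; apply/matrixP => i j;
   rewrite !mxE !invMg !permM.
Qed.

Lemma autotopy_group_set n (L : latin_square n) : group_set (autotopy L).
Proof.
apply/group_setP; split=> [|S T]; first by rewrite inE isotope1.
by rewrite !inE isotopeM => /eqP-> /eqP->.
Qed.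

Canonical autotopy_group n (L : latin_square n) : {group 'S_n * 'S_n * 'S_n} :=
  Group (autotopy_group_set L).

(* porbits s is the set of all cycles of s, fixed points included, each cycle
   being identified with its set of elements. *)
Definition nu n (s : 'S_n) : nat := #|porbits s|.

Definition cycle_structure n (s : 'S_n) : seq nat :=
  sort geq [seq #|C| | C : {set 'I_n} <- enum (porbits s)].

(* Here and in lambda_cycle, the default value n of the minimum is an upper
   bound of all the terms, so it has no influence over a nonempty range. *)
Definition nu_ls n (L : latin_square n) : nat :=
  \big[minn/n]_(i < n) nu (ls_row L i).

Definition lambda n (L : latin_square n) (s : 'I_n) : nat :=
  #|[set i | cycle_structure (ls_row L i) == cycle_structure (ls_row L s)]|.

Definition lambda_cycle n (L : latin_square n) (C : {set 'I_n}) : nat :=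
  \big[minn/n]_(s in C) lambda L s.

(* perm_eq is equality of multisets; (ls_row L m)^-1 * ls_row L i is
   sigma_i sigma_m^-1 composed from right to left. *)
Definition Delta n (L : latin_square n) : {set 'I_n} :=
  [set m | perm_eq
     [seq cycle_structure ((ls_row L m)^-1 * ls_row L i)%g | i <- enum 'I_n]
     [seq cycle_structure (ls_row L i) | i <- enum 'I_n]].

Definition delta n (L : latin_square n) : nat := #|Delta L|.

(* C lists the cycles of s, each exactly once, in some order. *)
Definition cycle_decomposition n (s : 'S_n) (C : seq {set 'I_n}) : Prop :=
  perm_eq C (enum (porbits s)).

(* Main.v *)
(* If (alpha, beta, gamma) is an autotopism, z the first row and m = alpha(z),
   then sigma_{alpha(i)} sigma_m^-1 = gamma sigma_i gamma^-1; hence m lies in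
   Delta(L), and the autotopisms with a given m form at most a coset of the
   subgroup fixing z.  On that subgroup beta = gamma, row alpha(i) is conjugate
   to row i by gamma, and gamma(i) = L(alpha(i), gamma(z)).  So gamma(z),
   alpha(l) and one value alpha(s) for s in each other cycle of sigma_l give
   gamma at a point of every cycle, and conjugacy of sigma_l with
   sigma_{alpha(l)} propagates gamma along the cycles. *)
Require Import Defs.
From mathcomp Require Import all_boot all_fingroup all_algebra.

Set Implicit Arguments.
Unset Strict Implicit.
Unset Printing Implicit Defensive.

Lemma porbit_conj (T : finType) (s t : {perm T}) (x : T) :
  porbit (s ^ t)%g (t x) = [set t y | y in porbit s x].
Proof.
apply/setP => y; apply/porbitP/imsetP => [[i ->]|[_ /porbitP[i ->] ->]].
  by exists ((s ^+ i)%g x); rewrite ?mem_porbit // -conjXg permJ.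
by exists i; rewrite -conjXg permJ.
Qed.

Lemma porbits_conj (T : finType) (s t : {perm T}) :
  porbits (s ^ t)%g = [set [set t y | y in C] | C : {set T} in porbits s].
Proof.
apply/setP => D; apply/imsetP/imsetP => [[x _ ->]|[_ /imsetP[x _ ->] ->]].
  exists (porbit s (t^-1 x)%g); first exact: imset_f.
  by rewrite -porbit_conj permKV.
by exists (t x); rewrite ?porbit_conj.
Qed.

Lemma cycle_structure_conj n (s t : 'S_n) :
  cycle_structure (s ^ t)%g = cycle_structure s.
Proof.
apply/perm_sortP.
- by move=> x y; rewrite /= leq_total.
- by move=> x y w /= le_xy le_wx; apply: leq_trans le_wx le_xy.
- by move=> x y /anti_leq.
set f : {set 'I_n} -> {set 'I_n} := fun C => [set t y | y in C].
have f_inj : injective f by apply: imset_inj; apply: perm_inj.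
(* Each cycle is replaced by its image under [t], of the same size, so that only the lists of cycles
   remain to be compared. *)
have -> : [seq #|C| | C : {set 'I_n} <- enum (porbits s)]
        = [seq #|C| | C : {set 'I_n} <- map f (enum (porbits s))].
  by rewrite -map_comp; apply: eq_map => C /=; rewrite card_imset //; apply: perm_inj.
apply: perm_map; apply: uniq_perm; rewrite ?enum_uniq ?map_inj_uniq ?enum_uniq //.
move=> D; rewrite mem_enum porbits_conj.
apply/imsetP/mapP => [[C sC ->]|[C sC ->]]; exists C; by rewrite ?mem_enum // -mem_enum.
Qed.

Lemma autotopyP n (L : latin_square n) (a b c : 'S_n) :
  reflect (forall i j, L (a i) (b j) = c (L i j)) ((a, b, c) \in autotopy L).
Proof.
rewrite inE; apply: (iffP eqP) => [eqL i j|eqL].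
  by rewrite -eqL mxE !permK eqL.
by apply/matrixP => i j; rewrite mxE -eqL !permKV.
Qed.

Lemma ls_col_inj n (L : latin_square n) j : injective (fun i => L i j).
Proof. by case: L => A /= /andP[_ /forallP/(_ j)/injectiveP]. Qed.

Lemma autotopy_row n (L : latin_square n) (a b c : 'S_n) i :
  (a, b, c) \in autotopy L -> ls_row L (a i) = (b^-1 * ls_row L i * c)%g.
Proof.
move/autotopyP => eqL; apply/permP => j.
by rewrite [LHS]permE !permM [ls_row L i _]permE -eqL permKV.
Qed.

Lemma autotopy_Delta n (L : latin_square n) (a b c : 'S_n) z :
  ls_row L z = 1%g -> (a, b, c) \in autotopy L -> a z \in Delta L.
Proof.
move=> Lz Aabc; rewrite inE.
set f := fun i => _; rewrite -/(map f _).
have fa i : f (a i) = cycle_structure (ls_row L i).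
  rewrite /f !(autotopy_row _ Aabc) Lz mulg1 invMg invgK !mulgA mulgK.
  by rewrite -mulgA -/(conjg _ _) cycle_structure_conj.
(* Both multisets are now values of [f], one reindexed along the bijection [a]. *)
rewrite -(eq_map fa) (map_comp f a) perm_map //.
apply: uniq_perm; rewrite ?(map_inj_uniq (@perm_inj _ a)) ?enum_uniq //.
move=> i; rewrite mem_enum; apply/esym/mapP; exists (a^-1 i)%g; rewrite ?mem_enum //.
by rewrite permKV.
Qed.

Lemma lambda_cycle_attained n (L : latin_square n) (D : {set 'I_n}) x :
  x \in D -> exists2 s, s \in D & lambda L s <= lambda_cycle L D.
Proof.
move=> Dx; case: (arg_minnP (lambda L) Dx) => s Ds min_s; exists s => //.
apply: (big_ind (leq (lambda L s))) => [|u v le_u le_v|i /min_s //].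
  (* The default value [n] of the minimum is harmless: [lambda L s] counts rows. *)
  by rewrite -[leqRHS]card_ord max_card.
by rewrite leq_min le_u.
Qed.

Section RowStabiliser.

Variables (n : nat) (L : latin_square n) (z : 'I_n).
Hypothesis L_row_z : forall i, L z i = i.
Hypothesis L_col_z : forall i, L i z = i.

Lemma ls_row_z : ls_row L z = 1%g.
Proof. by apply/permP => i; rewrite permE perm1 L_row_z. Qed.

Definition row_fixer : {set 'S_n * 'S_n * 'S_n} :=
  [set T in autotopy L | T.1.1 z == z].

Lemma row_fixer_eq a b c : (a, b, c) \in row_fixer -> b = c.
Proof.
rewrite inE => /andP[/autotopyP eqL /eqP /= az]; apply/permP => j.
by have := eqL z j; rewrite az !L_row_z.
Qed.

Lemma row_fixer_conj a b c i :
  (a, b, c) \in row_fixer -> ls_row L (a i) = (ls_row L i ^ c)%g.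
Proof.
move=> Tabc; have:= Tabc; rewrite inE => /andP[/autotopy_row-> _].
by rewrite (row_fixer_eq Tabc) -mulgA.
Qed.

Lemma row_fixer_val a b c i :
  (a, b, c) \in row_fixer -> c i = L (a i) (c z).
Proof.
move=> Tabc; have:= Tabc; rewrite inE => /andP[/autotopyP eqL _].
by rewrite -{2}(row_fixer_eq Tabc) eqL L_col_z.
Qed.

Lemma card_autotopy_leq : #|autotopy L| <= delta L * #|row_fixer|.
Proof.
pose first (T : 'S_n * 'S_n * 'S_n) := T.1.1 z.
rewrite -sum1_card (partition_big first (mem (Delta L))) => [|[[a b] c]] /=; last first.
  exact/autotopy_Delta/ls_row_z.
rewrite -sum_nat_const; apply: leq_sum => m _; rewrite sum1_card.
(* Right translation by the inverse of one element [T0] of a nonempty fibre embeds that fibre into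
   [row_fixer]. *)
case: (pickP [pred T in autotopy L | first T == m]) => [T0 /andP[AT0 /eqP T0m]|none].
  rewrite -(card_imset _ (mulIg T0^-1)%g); apply: subset_leq_card.
  apply/subsetP => _ /imsetP[T /andP[AT /eqP Tm] ->].
  rewrite inE groupM ?groupV //=.
  by rewrite permM -/(first T) Tm -T0m permK.
by rewrite eq_card0.
Qed.

(** The points [r i] meet every cycle of row [l] and include [l] itself. An element is encoded by
    [c z] and the values [a (r i)]; conjugacy of rows leaves at most [lambda L (r i)] choices for
    each of the latter. *)
Lemma card_row_fixer_leq k (l : 'I_n) (r : 'I_k -> 'I_n) :
    (exists i, r i = l) ->
    (forall x, exists i, x \in porbit (ls_row L l) (r i)) ->
  #|row_fixer| <= n * \prod_(i < k) lambda L (r i).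
Proof.
move=> [i0 r_i0] cover.
pose F (i : 'I_k) := [pred j |
  cycle_structure (ls_row L j) == cycle_structure (ls_row L (r i))].
pose code (T : 'S_n * 'S_n * 'S_n) :=
  (T.2 z, [ffun i : 'I_k => T.1.1 (r i)]).
have code_inj : {in row_fixer &, injective code}.
  move=> [[a b] c] [[a' b'] c'] T T' [eq_z /ffunP eq_r].
  have eq_a i : a (r i) = a' (r i) by have := eq_r i; rewrite !ffunE.
  have eq_c : c = c'.
    (* If [x] is the image of [r i] under the [t]-th power of row [l], then [c x] is the image of
       [c (r i)] under the [t]-th power of row [a l]. *)
    apply/permP => x; have [i /porbitP[t ->]] := cover x.
    rewrite -[LHS]permJ -[RHS]permJ !conjXg -(row_fixer_conj _ T) -(row_fixer_conj _ T').
    rewrite -r_i0 eq_a; congr (_ _).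
    by rewrite (row_fixer_val _ T) (row_fixer_val _ T') eq_a eq_z.
  rewrite (row_fixer_eq T) (row_fixer_eq T') -eq_c.
  (* Since [c i] is the entry of row [a i] in column [c z], and columns are injective, [c]
     determines [a]. *)
  congr (_, _, _); apply/permP => i; apply: (@ls_col_inj _ L (c z)).
  by rewrite -(row_fixer_val _ T) {2}eq_c -(row_fixer_val _ T') eq_c.
rewrite -(card_in_imset code_inj).
have <- : #|setX [set: 'I_n] [set f in family F]|
        = n * \prod_(i < k) lambda L (r i).
  rewrite cardsX cardsT card_ord cardsE card_family foldrE big_map big_enum /=.
  by congr (_ * _); apply: eq_bigr => i _; rewrite /lambda cardsE.
apply: subset_leq_card; apply/subsetP => _ /imsetP[[[a b] c] T ->].
rewrite in_setX in_setT in_set; apply/familyP => i; rewrite inE ffunE /=.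
by rewrite (row_fixer_conj _ T) cycle_structure_conj.
Qed.

End RowStabiliser.

Theorem theorem1 (n : nat) (L : latin_square n) (l : 'I_n)
    (C : seq {set 'I_n}) :
  reduced L ->
  nu (ls_row L l) = nu_ls L ->
  cycle_decomposition (ls_row L l) C ->
  l \in nth set0 C 0 ->
  (#|autotopy L| <= n * delta L * lambda L l *
    \prod_(1 <= i < nu_ls L) lambda_cycle L (nth set0 C i))%N.
Proof.
move=> redL <- decC lC0.
pose z := Ordinal (leq_ltn_trans (leq0n l) (ltn_ord l)).
have Lz i : L z i = i by have [] := redL z erefl i.
have Lz' i : L i z = i by have [] := redL z erefl i.
set s := ls_row L l in decC *.
have sizeC : size C = nu s by rewrite (perm_size decC) -cardE.
have memC D : (D \in C) = (D \in porbits s) by rewrite (perm_mem decC) mem_enum.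
have nu_gt0 : 0 < nu s.
  by rewrite -sizeC; case: (C) lC0 => //=; rewrite inE.
have orbC i x : i < nu s -> x \in nth set0 C i -> nth set0 C i = porbit s x.
  move=> lt_i; have: nth set0 C i \in C by rewrite mem_nth ?sizeC.
  rewrite memC => /imsetP[y _ ->] xy.
  by apply/eqP; rewrite eq_porbit_mem porbit_sym.
(* The representative of the first cycle must be [l], which need not minimise [lambda] there; the
   other cycles are free to use a minimiser. *)
pose bound (i : nat) := if i == 0 then lambda L l else lambda_cycle L (nth set0 C i).
have /fin_all_exists[r rP] (i : 'I_(nu s)) : exists x,
    [/\ x \in nth set0 C i, lambda L x <= bound i & val i == 0 -> x = l].
  rewrite /bound; case: eqP => [->|/= _]; first by exists l.
  have: nth set0 C i \in C by rewrite mem_nth ?sizeC.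
  rewrite memC => /imsetP[y _ eqC].
  have yC : y \in nth set0 C i by rewrite eqC porbit_id.
  by have [x] := @lambda_cycle_attained n L _ _ yC; exists x.
have r0 : exists i, r i = l.
  by exists (Ordinal nu_gt0); have [_ _ ->] := rP (Ordinal nu_gt0).
have cover x : exists i, x \in porbit s (r i).
  have Cx : porbit s x \in C by rewrite memC imset_f.
  have lt_i : index (porbit s x) C < nu s by rewrite -sizeC index_mem.
  exists (Ordinal lt_i); have [rC _ _] := rP (Ordinal lt_i).
  by rewrite -(orbC _ _ lt_i rC) nth_index // porbit_id.
apply: leq_trans (card_autotopy_leq Lz) _.
rewrite [n * _]mulnC -!mulnA leq_mul2l; apply/orP; right.
apply: leq_trans (card_row_fixer_leq Lz Lz' r0 cover) _.
rewrite leq_mul2l; apply/orP; right.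
apply: (@leq_trans (\prod_(i < nu s) bound i)).
  by apply: leq_prod => i _; have [] := rP i.
rewrite -(big_mkord xpredT bound) big_ltn //= leq_mul2l; apply/orP; right.
(* Keeping the range condition excludes index 0, the only one where [bound] is not
   [lambda_cycle]. *)
by rewrite big_nat [leqRHS]big_nat; apply: leq_prod => -[|i].
Qed.
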